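(* Let $G$ be a non-free Artin group of almost large type, with Huang–Osajda systolic complex $\mathcal X$, identity vertex $v_0$, and associated language $\mathcal L^0$ over $\mathcal A$. Suppose that $w\in\mathcal L^0$, that $w_1$ is a non-empty prefix of $w$, and let $w_2$ be the maximal proper prefix of $w_1$ (formed by deleting its last letter). Then there exists a word $w'\in\mathcal L^0$ that has $w_2$ as a prefix, with $$|w'|-|w_2|\le \max_{i\ne j}\{m_{ij}-1 : m_{ij}\neq\infty\}.$$
   Context: Here $|u|$ is the number of letters of a word $u$ over $\mathcal A$. **Directed geodesics.** $\mathcal X_\sigma$ denotes the link of a simplex $\sigma$. For a subcomplex $\mathcal Y$ and a simplex $\sigma$ of $\mathcal Y$, $\mathrm{Res}(\sigma,\mathcal Y)$ is the union of all closed simplices of $\mathcal Y$ containing $\sigma$, and $B_1(\sigma,\mathcal Y)$ is the union of all closed simplices of $\mathcal Y$ that meet $\sigma$. A sequence of simplices $\sigma_0,\dots,\sigma_n$ of $\mathcal X$ is a directed geodesic if (1) for $0\le i\le n-1$, $\sigma_i,\sigma_{i+1}$ are disjoint and span a simplex of $\mathcal X$, and (2) for $0\le i\le n-2$, $\mathrm{Res}(\sigma_i,\mathcal X_{\sigma_{i+1}})\cap B_1(\sigma_{i+2},\mathcal X_{\sigma_{i+1}})=\emptyset$. Since $\mathcal X$ is systolic, there is a unique directed geodesic between any ordered pair of vertices (Januszkiewicz–Świątkowski). **Artin groups.** Let $(m_{ij})$ be a Coxeter matrix: a symmetric matrix with $m_{ii}=1$ and $m_{ij}\in\{2,3,\dots\}\cup\{\infty\}$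 for $i\ne j$. For $m\in\mathbb N$ let ${}_m(a,a')$ be the alternating word of length $m$ in $a,a'$ starting with $a$. The Artin group is the group $G$ with generators $X=\{a_1,a_2,\dots\}$ (finitely many, one for each row of the matrix) and relations ${}_{m_{ij}}(a_i,a_j)={}_{m_{ij}}(a_j,a_i)$ for $i\ne j$, $m_{ij}<\infty$. Its Coxeter diagram has one node for each generator and an edge labelled $m_{ij}$ joining each pair $i\ne j$. $G$ has almost large type if (1) in any triangle of edges of the diagram either at least one edge is labelled $\infty$ or no edge has label 2, and (2) in any square (4-cycle) of edges either at least one edge is labelled $\infty$ or at most one edge has label 2. For $m_{ij}<\infty$, let $G_{ij}=\langle a_i,a_j\rangle$ and let $\Delta_{ij}$ be the element represented by ${}_{m_{ij}}(a_i,a_j)$. **The Huang–Osajda complex $\mathcal X$.** Let $\mathcal G$ be the (undirected) Cayley graph of $G$ over $X$: vertex set $G$, edges $\{g,ga_i\}$; $G$ acts by left multiplication. For each pair $i\neq j$ with $m=m_{ij}<\infty$ and each $g\in G$ there is a precell: the $2m$-cycle in $\mathcal G$ formed by its two half boundaries, the paths $p_0=g,p_1,\dots,p_m=g\Delta_{ij}$ labelled ${}_m(a_i,a_j)$ and $q_0=g,q_1,\dots,q_m=g\Delta_{ij}$ labelled ${}_m(a_j,a_i)$; $g$ is its initial vertex and $g\Delta_{ij}$ its terminal vertex. Each precell is triangulated: if $m=2$, by adding the edge $\{p_0,p_2\}$; if $m\ge3$, by adding $m-2$ new vertices $o_1,\dots,o_{m-2}$ and the edges $\{p_0,o_1\}$,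 $\{o_{m-2},p_m\}$, $\{o_s,o_{s+1}\}$ $(1\le s\le m-3)$, and $\{o_s,p_s\},\{o_s,p_{s+1}\},\{o_s,q_s\},\{o_s,q_{s+1}\}$ $(1\le s\le m-2)$. The added vertices are called interior vertices; the elements of $G$ are called real vertices. Next, whenever two distinct precells $\Pi,\Pi'$ for the same pair $\{i,j\}$ have boundaries meeting in a path with $l\ge2$ edges (this path is then a proper suffix of a half boundary of one, say $\Pi$, and a proper prefix of a half boundary of the other, $\Pi'$), then, writing $o_1,\dots,o_{m-2}$ and $o'_1,\dots,o'_{m-2}$ for the interior vertices of $\Pi$ and $\Pi'$ respectively, each list numbered in order from the initial vertex to the terminal vertex of its precell (so $o_1$ is adjacent to the initial vertex of $\Pi$ and $o_{m-2}$ to its terminal vertex, and likewise for $o'_1$, $o'_{m-2}$ and $\Pi'$), and $d_s=o_{m-1-l+s}$, $d'_s=o'_s$ for $1\le s\le l-1$, one adds the edges $\{d_s,d'_s\}$ $(1\le s\le l-1)$ and $\{d'_s,d_{s+1}\}$ $(1\le s\le l-2)$. The complex $\mathcal X_{ij}$ is the flag simplicial complex whose 1-skeleton is the graph obtained in this way from the Cayley graph of $G_{ij}$ (using the precells with $g\in G_{ij}$). The complex $\mathcal X$ is the union of $\mathcal G$ and all translates $h\mathcal X_{ij}$ ($h\in G$, $m_{ij}<\infty$), one for each coset $hG_{ij}$, distinct translates being glued only along their common part in $\mathcal G$. $G$ acts on $\mathcal X$, extending its action on $\mathcal G$, with trivial simplex stabilisers, and $\mathcal X$ is systolic. The vertex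 $v_0$ is the real vertex $1\in G$. **The language $\mathcal L^0$.** Let $V_0\ni v_0$ be a set of representatives of the $G$-orbits of simplices of $\mathcal X$. For a simplex $\sigma$ with representative $\bar\sigma\in V_0$, let $\lambda_\sigma$ be the unique element of $G$ with $\sigma=\lambda_\sigma\bar\sigma$. $\mathcal A$ is the set of symbols representing the identity and all elements $\lambda_\rho^{-1}\lambda_\tau$ with $\rho,\tau$ disjoint simplices that together span a simplex of $\mathcal X$. For $g\in G$ let $\sigma_0=v_0,\sigma_1,\dots,\sigma_n=gv_0$ be the directed geodesic from $v_0$ to $gv_0$; the corresponding word is $\mu_1\cdots\mu_n$ with $\mu_i=\lambda_{\sigma_{i-1}}^{-1}\lambda_{\sigma_i}\in\mathcal A$. $\mathcal L^0$ is the set of all these words, one for each $g\in G$. *)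

(* Defs.v *)
From mathcomp Require Import all_boot all_algebra.
From mathcomp Require Import boolp classical_sets cardinality.

Set Implicit Arguments.
Unset Strict Implicit.
Unset Printing Implicit Defensive.

Local Open Scope classical_set_scope.

(* The letter [(b, true)] stands for [b], the letter [(b, false)] for its
   formal inverse. *)
Definition gword (B : Type) : Type := seq (B * bool).

Definition eval (G : groupType) (B : Type) (a : B -> G) (w : gword B) : G :=
  (\prod_(x <- w) (if x.2 then a x.1 else (a x.1)^-1))%g.

Inductive word_equiv (B : Type) (rel : gword B -> gword B -> Prop) :
    gword B -> gword B -> Prop :=
| we_refl w : word_equiv rel w w
| we_sym v w : word_equiv rel v w -> word_equiv rel w v
| we_trans u v w :
    word_equiv rel u v -> word_equiv rel v w -> word_equiv rel u w
| we_cancel u v b e :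
    word_equiv rel (u ++ [:: (b, e); (b, ~~ e)] ++ v) (u ++ v)
| we_rel u v r r' : rel r r' -> word_equiv rel (u ++ r ++ v) (u ++ r' ++ v).

(* G = < a b (b : B) | r = r' whenever rel r r' > *)
Definition presented_by (G : groupType) (B : Type) (a : B -> G)
    (rel : gword B -> gword B -> Prop) : Prop :=
  (forall g, exists w, eval a w = g) /\
  (forall v w, eval a v = eval a w <-> word_equiv rel v w).

Definition free_group (G : groupType) : Prop :=
  exists (B : Type) (a : B -> G), presented_by a (fun _ _ => False).

(* the subgroup generated by S *)
Definition generated (G : groupType) (S : set G) : set G :=
  smallest (fun H : set G =>
    H 1%g /\ forall x y, H x -> H y -> H (x * y^-1)%g) S.

(* [None] is the label infinity. *)
Definition coxeter_matrix n (M : 'M[option nat]_n) : Prop :=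
  [/\ forall i, M i i = Some 1,
      forall i j, M i j = M j i &
      forall i j m, i != j -> M i j = Some m -> 2 <= m].

(* x y x y ... , of length m *)
Definition alternating (T : Type) (m : nat) (x y : T) : seq T :=
  mkseq (fun k => if odd k then y else x) m.

Definition alt_word (B : Type) (m : nat) (x y : B) : gword B :=
  alternating m (x, true) (y, true).

Definition artin_rel n (M : 'M[option nat]_n) (r r' : gword 'I_n) : Prop :=
  exists i j m,
    [/\ i != j, M i j = Some m, r = alt_word m i j & r' = alt_word m j i].

Definition artin_group n (M : 'M[option nat]_n) (G : groupType)
    (a : 'I_n -> G) : Prop :=
  presented_by a (artin_rel M).

Definition almost_large_type n (M : 'M[option nat]_n) : Prop :=
  (forall i j k : 'I_n, uniq [:: i; j; k] ->
     let labels := [:: M i j; M j k; M k i] in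
     None \in labels \/ Some 2 \notin labels) /\
  (forall i j k l : 'I_n, uniq [:: i; j; k; l] ->
     let labels := [:: M i j; M j k; M k l; M l i] in
     None \in labels \/ count_mem (Some 2) labels <= 1).

(* [Interior i j g s] is the vertex o_s of the precell for {i, j} with initial
   vertex g. It is only used with i < j, so that each precell has one name, and
   with 1 <= s <= m_ij - 2; the other terms lie in no simplex. *)
Inductive vertex n (G : groupType) : Type :=
| Real of G
| Interior of 'I_n & 'I_n & G & nat.

Arguments Real {n G} _.
Arguments Interior {n G} _ _ _ _.

Definition act_vertex n (G : groupType) (h : G) (v : vertex n G) : vertex n G :=
  match v with
  | Real g => Real (h * g)%g
  | Interior i j g s => Interior i j (h * g)%g s
  end.

Definition act n (G : groupType) (h : G) (sigma : set (vertex n G)) :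
    set (vertex n G) :=
  act_vertex h @` sigma.

Section Complex.
Variables (n : nat) (M : 'M[option nat]_n) (G : groupType) (a : 'I_n -> G).

Local Notation V := (vertex n G).

Section Pair.
Variables (i j : 'I_n) (m : nat).

Definition Gpair : set G := generated [set a i; a j].

(* k-th vertex of a half boundary of the precell at g: p_k for c = true and
   q_k for c = false *)
Definition half (c : bool) (g : G) (k : nat) : G :=
  (g * eval a (if c then alt_word k i j else alt_word k j i))%g.

Definition boundary_vertices (g : G) : set G :=
  [set x | exists c k, k <= m /\ x = half c g k].

Definition boundary_edges (g : G) : set (set G) :=
  [set e | exists c k, k < m /\ e = [set half c g k; half c g k.+1]].

(* The boundaries of the precells at g (the cell Pi) and g' (the cell Pi')
   intersect exactly in a path with l >= 2 edges, which is a proper suffix of a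
   half boundary of Pi and a proper prefix of a half boundary of Pi'. *)
Definition meet_in_path (g g' : G) (l : nat) : Prop :=
  [/\ g <> g', 2 <= l, l < m &
   exists c c' : bool,
     [/\ forall t, t <= l -> half c g (m - l + t) = half c' g' t,
         boundary_vertices g `&` boundary_vertices g' =
           [set x | exists t, t <= l /\ x = half c' g' t] &
         boundary_edges g `&` boundary_edges g' =
           [set e | exists t,
              t < l /\ e = [set half c' g' t; half c' g' t.+1]]]].

Inductive pair_edge : V -> V -> Prop :=
| edge_cayley g k : Gpair g -> k \in [:: i; j] ->
    pair_edge (Real g) (Real (g * a k)%g)
| edge_diagonal g : Gpair g -> m = 2 ->
    pair_edge (Real g) (Real (half true g 2))
| edge_initial g : Gpair g -> 3 <= m ->
    pair_edge (Real g) (Interior i j g 1)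
| edge_terminal g : Gpair g -> 3 <= m ->
    pair_edge (Interior i j g (m - 2)) (Real (half true g m))
| edge_spine g s : Gpair g -> 3 <= m -> 1 <= s <= m - 3 ->
    pair_edge (Interior i j g s) (Interior i j g s.+1)
| edge_side g s c t : Gpair g -> 3 <= m -> 1 <= s <= m - 2 ->
    t \in [:: s; s.+1] ->
    pair_edge (Interior i j g s) (Real (half c g t))
| edge_rung g g' l s : Gpair g -> Gpair g' -> meet_in_path g g' l ->
    1 <= s <= l - 1 ->
    pair_edge (Interior i j g (m - 1 - l + s)) (Interior i j g' s)
| edge_zigzag g g' l s : Gpair g -> Gpair g' -> meet_in_path g g' l ->
    1 <= s <= l - 2 ->
    pair_edge (Interior i j g' s) (Interior i j g (m - 1 - l + s.+1)).

Definition pair_vertex (v : V) : Prop :=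
  (exists g, Gpair g /\ v = Real g) \/
  (exists g s, [/\ Gpair g, 1 <= s <= m - 2 & v = Interior i j g s]).

(* simplices of X_ij, the flag complex of the graph [pair_edge] *)
Definition pair_simplex (tau : set V) : Prop :=
  [/\ finite_set tau, tau !=set0, tau `<=` pair_vertex &
      forall u v, tau u -> tau v -> u <> v -> pair_edge u v \/ pair_edge v u].

End Pair.

(* The simplices of X, as vertex sets. Sharing real vertices is what glues the
   translates of the X_ij along the Cayley graph. *)
Definition complexX : set (set V) :=
  [set sigma |
     [\/ exists g, sigma = [set Real g],
         exists g k, sigma = [set Real g; Real (g * a k)%g] |
         exists (i j : 'I_n) m h tau,
           [/\ i < j, M i j = Some m, pair_simplex i j m tau &
               sigma = act h tau]]].

(* A subcomplex is given by its set of (nonempty) simplices; the same goes for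
   the unions of closed simplices [Res] and [B1]. *)
Definition link (X : set (set V)) (sigma : set V) : set (set V) :=
  [set tau | [/\ X tau, tau `&` sigma = set0 & X (tau `|` sigma)]].

Definition Res (sigma : set V) (Y : set (set V)) : set (set V) :=
  [set tau | tau !=set0 /\
     exists rho, [/\ Y rho, sigma `<=` rho & tau `<=` rho]].

Definition B1 (sigma : set V) (Y : set (set V)) : set (set V) :=
  [set tau | tau !=set0 /\
     exists rho, [/\ Y rho, rho `&` sigma !=set0 & tau `<=` rho]].

Definition directed_geodesic (X : set (set V)) (s : seq (set V)) : Prop :=
  let sigma := nth set0 s in
  [/\ forall k, k < size s -> X (sigma k),
      forall k, k.+1 < size s ->
        sigma k `&` sigma k.+1 = set0 /\ X (sigma k `|` sigma k.+1) &
      forall k, k.+2 < size s ->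
        Res (sigma k) (link X (sigma k.+1)) `&`
        B1 (sigma k.+2) (link X (sigma k.+1)) = set0].

Definition v0 : set V := [set Real 1%g].

Definition orbit_representatives (V0 : set (set V)) : Prop :=
  [/\ V0 `<=` complexX, V0 v0 &
      forall sigma, complexX sigma ->
        exists! rep, V0 rep /\ exists g, sigma = act g rep].

(* the g with sigma = g rep, where rep is the representative of sigma *)
Definition lam (V0 : set (set V)) (sigma : set V) : G :=
  xget 1%g [set g | exists2 rep, V0 rep & sigma = act g rep].

(* The alphabet A, each symbol being identified with the element of G that it
   represents; words over A are then elements of [seq G]. *)
Definition alphabet (V0 : set (set V)) : set G :=
  [set x | x = 1%g \/
     exists rho tau, [/\ complexX rho, complexX tau, rho `&` tau = set0,
       complexX (rho `|` tau) & x = ((lam V0 rho)^-1 * lam V0 tau)%g]].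

Definition word_of (V0 : set (set V)) (sigma : set V) (s : seq (set V)) :
    seq G :=
  pairmap (fun rho tau => (lam V0 rho)^-1 * lam V0 tau)%g sigma s.

Definition languageL0 (V0 : set (set V)) : set (seq G) :=
  [set w | exists g s,
     [/\ directed_geodesic complexX (v0 :: s), last v0 s = act g v0 &
         w = word_of V0 v0 s]].

Lemma languageL0_alphabet (V0 : set (set V)) (w : seq G) :
  languageL0 V0 w -> forall x, x \in w -> alphabet V0 x.
Proof.
move=> [g [s [[simp adj _] _ ->]]] x /(nthP 1%g)[k].
rewrite size_pairmap => ks <-; rewrite (nth_pairmap set0) //.
have [dis span] := adj k ks.
by right; exists (nth set0 (v0 :: s) k), (nth set0 s k); split;
   [exact/simp/ltnW | exact: (simp k.+1) | | |].
Qed.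

End Complex.

(* Main.v *)
Require Import Defs.
From mathcomp Require Import all_boot all_order all_algebra all_field.
From mathcomp Require Import boolp classical_sets cardinality zify ring.

(* Only the local structure of the complex matters.  Let sigma be the last
   simplex of the truncated geodesic and tau the simplex that follows it in the
   original one.  If sigma is not a real vertex, tau can be replaced by any one
   of its vertices u, since this only shrinks B_1.  A real u finishes.  If u is
   the interior vertex o_s of a precell, its link retracts onto the hexagon
   p_s, p_(s+1), o_(s+1), q_(s+1), q_s, o_(s-1) (with p_m for o_(m-1) and p_0 for
   o_0) by a map that sends adjacent vertices to equal or adjacent ones.  So the
   hexagon vertex opposite to the image of a vertex of sigma is at distance at
   least 3 from it and is a legal next step.  It is either real, or else the
   next vertex of the spine, along which one continues to p_0 or p_m; this takes
   at most m - 1 steps, the step to u included.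

   The retraction only needs non-adjacencies, and these are detected by the
   exponent sum G -> Z and by the action of G through its Coxeter group: a
   Tits-type reflection representation over the algebraic numbers distinguishes
   the 2 m elements of each dihedral parabolic subgroup, which form a 2 m-cycle. *)

Set Implicit Arguments.
Unset Strict Implicit.
Unset Printing Implicit Defensive.

Import Order.TTheory GRing.Theory Num.Theory.

Local Open Scope ring_scope.

(** * Reflections *)

(** The sign is a direction around the 2 m-cycle of a dihedral group: [true] runs along the p_t of a
    precell, [false] along the q_t. *)
Definition sg (e : bool) (x : int) : int := if e then x else - x.

Lemma alternatingS (T : Type) k (x y : T) :
  alternating k.+1 x y = x :: alternating k y x.
Proof.
rewrite /alternating /mkseq /= (iotaDl 1 0) -map_comp; congr cons.
by apply: eq_map => t /=; case: odd.
Qed.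

Section Reflections.
Variables (n : nat) (z : 'I_n -> 'I_n -> algC).
Local Notation vec := ('I_n -> algC).

(* The reflection x_k -> - x_k + \sum_(l <> k) c_(kl) x_l with
   c_(kl) = 1 + z_(kl); when z_(lk) = z_(kl)^-1 is a primitive m-th root of
   unity, c_(kl) c_(lk) = 4 cos^2 (r pi / m) for some r prime to m. *)
Definition refl (k : 'I_n) (x : vec) : vec := fun l =>
  if l == k then - x k + \sum_(l' | l' != k) (1 + z k l') * x l' else x l.

(* Letters and their inverses act alike, as reflections are involutions. *)
Definition walk (w : gword 'I_n) (x : vec) : vec :=
  foldl (fun x b => refl b.1 x) x w.

Lemma reflK k : involutive (refl k).
Proof.
move=> x; apply: funext => l; rewrite /refl eqxx.
case: eqP => [->|//].
rewrite [X in _ + X](eq_bigr (fun l' => (1 + z k l') * x l')).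
  by rewrite opprD opprK subrK.
by move=> l' /negbTE ->.
Qed.

End Reflections.

(** * Dihedral orbits in a plane *)

Section Plane.
Variables (n : nat) (z : 'I_n -> 'I_n -> algC).
Local Notation vec := ('I_n -> algC).
Variables (i j : 'I_n).
Hypotheses (ij : i != j) (zji : z j i = (z i j)^-1) (z1 : z i j != 1)
  (z0 : z i j != 0).
Local Notation q := (z i j).

(* For a common fixed point x of the reflections i and j, the coordinates (u, v)
   on the plane x + <e_i, e_j> turn them into (u, v) -> (v, u) and
   (u, v) -> (q v, q^-1 u). *)
Definition plane (x : vec) (u v : algC) : vec := fun l =>
  if l == i then x i + (u + q * v) else if l == j then x j + (u + v) else x l.

Lemma refl_fixed k x : refl z k x = x ->
  \sum_(l | l != k) (1 + z k l) * x l = x k *+ 2.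
Proof.
move/(congr1 (@^~ k)); rewrite /refl eqxx => /(canRL (addKr _)) ->.
by rewrite opprK mulr2n.
Qed.

Lemma refl_plane_l x u v :
  refl z i x = x -> refl z i (plane x u v) = plane x v u.
Proof.
move=> /refl_fixed; rewrite (bigD1 j) 1?eq_sym //= => xi.
apply: funext => l; rewrite /refl /plane eqxx.
case: eqP => [_|_]; last by case: eqP => // _; rewrite (addrC u).
rewrite (bigD1 j) 1?eq_sym //= eqxx (negbTE ij).
rewrite (eq_bigr (fun l' => (1 + z i l') * x l')); last first.
  by move=> l' /andP[/negbTE -> /negbTE ->].
by move/(canRL (addKr _)): xi => ->; ring.
Qed.

Lemma refl_plane_r x u v :
  refl z j x = x -> refl z j (plane x u v) = plane x (q * v) (q^-1 * u).
Proof.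
move=> /refl_fixed; rewrite (bigD1 i) //= zji => xj.
apply: funext => l; rewrite /refl /plane eqxx.
case: (eqVneq l j) => [->|_].
  rewrite eq_sym (negbTE ij).
  rewrite (bigD1 i) //= eqxx zji.
  rewrite (eq_bigr (fun l' => (1 + z j l') * x l')); last first.
    by move=> l' /andP[/negbTE -> /negbTE ->].
  by move/(canRL (addKr _)): xj => ->; field.
by case: eqP => // _; rewrite mulrA divff // mul1r (addrC u).
Qed.

(** Being fixed by both reflections is a 2 x 2 linear system for the coordinates at [i] and [j],
    with determinant D = - (q - 1)^2 / q; the other coordinates are kept from [x]. *)
Lemma plane_exists x : exists x0 u v,
  [/\ refl z i x0 = x0, refl z j x0 = x0 & x = plane x0 u v].
Proof.
pose A := \sum_(l | (l != i) && (l != j)) (1 + z i l) * x l.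
pose B := \sum_(l | (l != j) && (l != i)) (1 + z j l) * x l.
pose D := 4 - (1 + q) * (1 + q^-1).
have q10 : q - 1 != 0 by rewrite subr_eq0.
have D0 : D != 0.
  have -> : D = - ((q - 1) ^+ 2 / q) by rewrite /D; field.
  by rewrite oppr_eq0 mulf_neq0 ?invr_eq0 // expf_neq0.
pose xi := (2 * A + (1 + q) * B) / D.
pose xj := (2 * B + (1 + q^-1) * A) / D.
pose x0 : vec := fun l => if l == i then xi else if l == j then xj else x l.
(* These solve u + q v = x_i - xi and u + v = x_j - xj. *)
exists x0, ((q * (x j - xj) - (x i - xi)) / (q - 1)),
  (((x i - xi) - (x j - xj)) / (q - 1)).
have x0i : x0 i = xi by rewrite /x0 eqxx.
have x0j : x0 j = xj by rewrite /x0 eq_sym (negbTE ij) eqxx.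
split; apply: funext => l; rewrite /refl /plane.
- case: eqP => // ->; rewrite (bigD1 j) 1?eq_sym //= x0i x0j.
  rewrite (eq_bigr (fun l' => (1 + z i l') * x l')).
    rewrite -/A /xi /xj /D; field; rewrite z0 /=.
    by move: D0; rewrite /D; apply: contra => /eqP E; apply/eqP;
       apply: (mulIf z0); rewrite mul0r -[RHS]E; field.
  by move=> l' /andP[/negbTE l'i /negbTE l'j]; rewrite /x0 l'i l'j.
- case: eqP => // ->; rewrite (bigD1 i) //= x0i x0j zji.
  rewrite (eq_bigr (fun l' => (1 + z j l') * x l')).
    rewrite -/B /xi /xj /D; field; rewrite z0 /=.
    by move: D0; rewrite /D; apply: contra => /eqP E; apply/eqP;
       apply: (mulIf z0); rewrite mul0r -[RHS]E; field.
  by move=> l' /andP[/negbTE l'i /negbTE l'j]; rewrite /x0 l'i l'j.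
case: eqP => [->|/eqP li]; first by rewrite x0i; field.
case: eqP => [->|/eqP lj]; first by rewrite x0j; field.
by rewrite /x0 (negbTE li) (negbTE lj).
Qed.

Definition letter (c : bool) : 'I_n := if c then i else j.

(* The orbit of (u, v), unrolled along Z: the element at position
   p = 2 k + b has neighbours p - 1 and p + 1, where i exchanges 2 k and 2 k + 1,
   and j exchanges 2 k + 1 and 2 k + 2. *)
Definition orb (x : vec) (u v : algC) (k : int) (b : bool) : vec :=
  if b then plane x (q ^ (- k) * v) (q ^ k * u)
  else plane x (q ^ k * u) (q ^ (- k) * v).

Definition orbit_at (x : vec) (u v : algC) (p : int) (b : bool) (y : vec) :=
  exists k : int, p = k * 2 + b%:Z /\ y = orb x u v k b.

Lemma orbit_step x u v p b y c :
  refl z i x = x -> refl z j x = x -> orbit_at x u v p b y ->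
  orbit_at x u v (p + sg (c (+) b) 1) (~~ b) (refl z (letter c) y).
Proof.
move=> xi xj [k [-> ->]].
have qD r : q * q ^ r = q ^ (r + 1) by rewrite expfzDr // expr1z mulrC.
have qB r : q^-1 * q ^ r = q ^ (r - 1) by rewrite expfzDr // exprN1 mulrC.
case: c; case: b => /=; rewrite /orb ?refl_plane_l ?refl_plane_r //.
- by exists k; split => //; rewrite addrK addr0.
- by exists k; split => //; rewrite addr0.
- exists (k + 1); split; first by rewrite mulrDl /=; lia.
  by rewrite /orb !mulrA qD qB opprD.
- exists (k - 1); split; first by rewrite mulrBl /=; lia.
  by rewrite /orb !mulrA qD qB opprB addrC.
Qed.

(** Letter and parity both flip at each step, so an alternating word keeps moving in one
    direction. *)
Lemma walk_alt x u v t p b y c :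
  refl z i x = x -> refl z j x = x -> orbit_at x u v p b y ->
  orbit_at x u v (p + sg (c (+) b) t%:Z) (b (+) odd t)
    (walk z (alt_word t (letter c) (letter (~~ c))) y).
Proof.
move=> xi xj; elim: t p b y c => [|t IH] p b y c hy.
  by case: (c (+) b); rewrite /= ?oppr0 addr0 addbF.
rewrite /alt_word alternatingS /=.
have := IH _ _ _ (~~ c) (orbit_step c xi xj hy).
rewrite negbK addNb addbN negbK addbN -addNb => h.
have -> : p + sg (c (+) b) t.+1 = p + sg (c (+) b) 1 + sg (c (+) b) t.
  by case: (c (+) b) => /=; lia.
by [].
Qed.

(** From position 0 the two words reach m and - m. These differ by 2 m, hence their indices k by m,
    which q^m = 1 makes invisible. *)
Lemma braid x m : q ^+ m = 1 ->
  walk z (alt_word m i j) x = walk z (alt_word m j i) x.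
Proof.
move=> qm; have [x0 [u [v [xi xj ->]]]] := plane_exists x.
have h0 : orbit_at x0 u v 0 false (plane x0 u v).
  by exists 0; rewrite /orb oppr0 expr0z !mul1r.
have [k [hk ->]] := walk_alt m true xi xj h0.
have [k' [hk' ->]] := walk_alt m false xi xj h0.
have kE : k = k' + m by move: hk hk' => /=; case: odd => /=; lia.
have qk : q ^ k = q ^ k' by rewrite kE exprzDr ?unitfE // -exprnP qm mulr1.
by rewrite /orb -!invr_expz qk.
Qed.

(** The coordinate at [j] is q^k, which gives k modulo m; the one at [i] is q^k or q^(k+1) according
    to [b], and q is not 1. *)
Lemma orbit_uniq m p b p' b' y : m.-primitive_root q ->
  orbit_at (fun=> 0) 1 0 p b y -> orbit_at (fun=> 0) 1 0 p' b' y ->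
  b = b' /\ exists r : int, p - p' = r * (2 * m%:Z).
Proof.
move=> qm [k [-> ->]] [k' [-> E]].
have Ei := congr1 (@^~ i) E; have Ej := congr1 (@^~ j) E.
have qk0 r : q ^ r != 0 by rewrite expfz_neq0.
have qk : q ^ k = q ^ k'.
  move: Ej; case: (b) (b') => -[]; rewrite /orb /plane eqxx eq_sym (negbTE ij);
  by rewrite ?mulr1 ?mulr0 ?addr0 ?add0r.
have bb : b = b'.
  have q1 : q * q ^ k' <> q ^ k'.
    by rewrite -[RHS]mul1r => /(mulIf (qk0 k')) /eqP; apply/negP.
  move: Ei; case: (b) (b') => -[]; rewrite /orb /plane eqxx qk;
  by rewrite ?mulr1 ?mulr0 ?addr0 ?add0r // => /esym.
split=> //; have : q ^ (k - k') = 1.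
  by rewrite expfzDr // qk -expfzDr // subrr expr0z.
case kk: (k - k') => [a|a] qa.
  have /dvdnP[r ar] : (m %| a)%N by rewrite (prim_order_dvd qm); apply/eqP.
  by exists r%:Z; rewrite bb; nia.
have /dvdnP[r ar] : (m %| a.+1)%N.
  rewrite (prim_order_dvd qm) -[q ^+ _]invrK.
  by rewrite -[(q ^+ _)^-1]/(q ^ Negz a) qa invr1.
by exists (- r%:Z); rewrite bb; nia.
Qed.

End Plane.

(** * Invariants of the Artin group from roots of unity *)

Definition braid_roots n (M : 'M[option nat]_n) (z : 'I_n -> 'I_n -> algC) :=
  forall (i j : 'I_n) m, (i < j)%N -> M i j = Some m ->
    m.-primitive_root (z i j) /\ z j i = (z i j)^-1.

Lemma braid_roots_exist n (M : 'M[option nat]_n) : coxeter_matrix M ->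
  exists z, braid_roots M z.
Proof.
move=> [_ Msym M2].
(* The order is [m.-1.+1], equal to m because m >= 2; the label infinity gets the root 1. *)
pose r (k : option nat) := sval (C_prim_root_exists (ltn0Sn (odflt 0%N k).-1)).
exists (fun i j : 'I_n => if (i < j)%N then r (M i j) else (r (M i j))^-1).
move=> i j m ij Mij.
rewrite [(j < i)%N]ltnNge (ltnW ij) ij /= -(Msym i) Mij; split=> //.
have : (2 <= m)%N by apply: (M2 i j m) => //; rewrite neq_ltn ij.
by rewrite /r; case: C_prim_root_exists => /= x; case: m {Mij}.
Qed.

Definition wlen (B : Type) (w : gword B) : int :=
  \sum_(x <- w) (if x.2 then 1 else -1).

Lemma wlen_alt (B : Type) k (x y : B) : wlen (alt_word k x y) = k%:Z.
Proof.
elim: k x y => [|k IH] x y; rewrite /wlen /alt_word; first by rewrite big_nil.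
by rewrite alternatingS big_cons [X in _ + X]IH.
Qed.

Lemma eval_cat (G : groupType) (B : Type) (a : B -> G) v w :
  eval a (v ++ w) = (eval a v * eval a w)%g.
Proof. by rewrite /eval big_cat. Qed.

Lemma eval1 (G : groupType) (B : Type) (a : B -> G) x :
  eval a [:: x] = if x.2 then a x.1 else (a x.1)^-1%g.
Proof. by rewrite /eval big_seq1. Qed.

Section Coordinates.
Variables (n : nat) (M : 'M[option nat]_n) (G : groupType) (a : 'I_n -> G).
Hypotheses (hM : coxeter_matrix M) (hG : artin_group M a).

(** Both sides of a braid relation are positive words of length m, and cancelling pairs have
    exponent sum 0. *)
Lemma eval_wlen v w : eval a v = eval a w -> wlen v = wlen w.
Proof.
case: hG => _ E /E; elim=> //.
- by move=> {}u {}v {}w _ -> _ ->.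
- move=> {}u {}v x e; rewrite /wlen !big_cat /= !big_cons big_nil.
  by case: e; rewrite /= ?addr0 ?subrr ?addNr add0r.
- move=> {}u {}v r r' [i [j [m [_ _ -> ->]]]].
  have := wlen_alt m i j; have := wlen_alt m j i.
  by rewrite /wlen !big_cat /= => -> ->.
Qed.

Section Roots.
Variable z : 'I_n -> 'I_n -> algC.
Hypothesis hz : braid_roots M z.

Lemma root_neq (i j : 'I_n) m : (i < j)%N -> M i j = Some m ->
  [/\ i != j, z i j != 1, z i j != 0 & z i j ^+ m = 1].
Proof.
move=> ij Mij; have [zp _] := hz ij Mij.
have nij : i != j by rewrite neq_ltn; apply/orP; left.
have m2 : (2 <= m)%N by case: hM => _ _; apply; last exact: Mij.
split; rewrite ?(prim_expr_order zp) //.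
  apply/eqP=> z1; have := eq_prim_root_expr zp 1 0.
  by rewrite z1 !expr1n eqxx mod0n modn_small // => /esym.
by rewrite (prim_root_eq0 zp); apply/eqP => m0; rewrite m0 in m2.
Qed.

Lemma eval_walk v w x : eval a v = eval a w -> walk z v x = walk z w x.
Proof.
case: hG => _ E /E vw; elim: vw x => //.
- by move=> {}u {}v {}w _ + _ + x => -> ->.
- by move=> {}u {}v b e x; rewrite /walk !foldl_cat /= reflK.
- move=> {}u {}v r r' [i [j [m [ij Mij -> ->]]]] x.
  rewrite /walk !foldl_cat; congr foldl; rewrite -!/(walk _ _ _).
  case: (ltngtP i j) ij => [ij _|ij _|/val_inj ->]; rewrite ?eqxx //.
    have [? ? ? ?] := root_neq ij Mij; have [_ ?] := hz ij Mij.
    exact: braid.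
  (* [braid_roots] speaks of increasing pairs only; the matrix and the relation are symmetric. *)
  have Mji : M j i = Some m by case: hM => _ <-.
  have [? ? ? ?] := root_neq ij Mji; have [_ ?] := hz ij Mji.
  by apply/esym/braid.
Qed.

Variables (i j : 'I_n) (m : nat).
Hypotheses (ij : (i < j)%N) (Mij : M i j = Some m).

(** The vector e_i + e_j; by [orbit_uniq] its orbit tells positions apart modulo 2 m. *)
Definition origin := orb z i j (fun=> 0) 1 0 0 false.

(* For h in g G_ij, p is a position of g^-1 h on the 2 m-cycle of the dihedral
   group (lifted to Z), b the parity of p, and y the exponent sum of g^-1 h. *)
Definition located (g h : G) (p : int) (b : bool) (y : int) := exists w,
  [/\ h = (g * eval a w)%g, wlen w = y &
      orbit_at z i j (fun=> 0) 1 0 p b (walk z w origin)].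

Lemma located0 g : located g g 0 false 0.
Proof.
exists [::]; split; first by rewrite /eval big_nil mulg1.
- by rewrite /wlen big_nil.
- by exists 0.
Qed.

Lemma located_uniq g h p b y p' b' y' :
  located g h p b y -> located g h p' b' y' ->
  y = y' /\ exists r : int, p - p' = r * (2 * m%:Z).
Proof.
move=> [w [-> <- hw]] [w' [+ <- hw']] => /mulgI E.
split; first exact: eval_wlen.
have [? ? ? ?] := root_neq ij Mij; have [? ?] := hz ij Mij.
rewrite (eval_walk _ E) in hw.
by have [] : b = b' /\ exists r : int, p - p' = r * (2 * m%:Z)
  by apply: orbit_uniq hw hw'.
Qed.

Lemma refl0 k : refl z k (fun=> 0) = fun=> 0.
Proof.
apply: funext => l; rewrite /refl; case: eqP => // _.
by rewrite oppr0 add0r big1 // => l' _; rewrite mulr0.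
Qed.

(** A generator and its inverse move the position alike, as reflections are involutions; only the
    exponent sum sees the sign [e]. *)
Lemma located_letter g h p b y c e :
  located g h p b y ->
  located g (h * (if e then a (letter i j c) else (a (letter i j c))^-1))%g
    (p + sg (c (+) b) 1) (~~ b) (y + (if e then 1 else -1)).
Proof.
have [? ? ? ?] := root_neq ij Mij; have [? ?] := hz ij Mij.
move=> [w [-> <- hw]]; exists (w ++ [:: (letter i j c, e)]); split.
- by rewrite eval_cat eval1 mulgA.
- by rewrite /wlen big_cat big_seq1.
- by rewrite /walk foldl_cat /=; apply: orbit_step => //; exact: refl0.
Qed.

Lemma half0 c (g : G) : Defs.half a i j c g 0 = g.
Proof. by rewrite /Defs.half; case: c; rewrite /eval big_nil mulg1. Qed.

Lemma half_step c (g : G) t :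
  Defs.half a i j c g t.+1 = Defs.half a i j (~~ c) (g * a (letter i j c))%g t.
Proof.
by rewrite /Defs.half -mulgA; congr (_ * _)%g; case: c;
   rewrite /alt_word alternatingS -cat1s eval_cat eval1.
Qed.

Lemma located_half g h p b y c t : located g h p b y ->
  located g (Defs.half a i j c h t) (p + sg (c (+) b) t%:Z) (b (+) odd t)
    (y + t%:Z).
Proof.
elim: t h p b y c => [|t IH] h p b y c hc.
  by rewrite half0 addr0 addbF; case: (c (+) b); rewrite /= ?oppr0 addr0.
have := IH _ _ _ _ (~~ c) (located_letter c true hc).
rewrite half_step addbN addNb negbK addNb /= addbN.
have -> : p + sg (c (+) b) 1 + sg (c (+) b) t = p + sg (c (+) b) t.+1.
  by case: (c (+) b) => /=; lia.
by have -> : y + 1 + t%:Z = y + t.+1%:Z by lia.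
Qed.

Lemma located_half_back g h p b y c t : located g (Defs.half a i j c h t) p b y ->
  exists b', b = b' (+) odd t /\
  located g h (p - sg (c (+) b') t%:Z) b' (y - t%:Z).
Proof.
elim: t h c => [|t IH] h c.
  rewrite half0 => hb; exists b; rewrite addbF subr0; split=> //.
  by case: (c (+) b); rewrite /= ?oppr0 subr0.
rewrite half_step => /IH[b' [bb h']]; exists (~~ b'); split.
  by rewrite addNb -addbN /= bb negbK.
have := located_letter c false h'; rewrite /= -mulgA mulgV mulg1.
have -> : y - t%:Z - 1 = y - t.+1%:Z by lia.
have -> // : p - sg (~~ c (+) b') t + sg (c (+) b') 1 =
    p - sg (c (+) ~~ b') t.+1.
by case: (c) (b') => -[] /=; lia.
Qed.

End Roots.
End Coordinates.

(** * Sectors of the link of an interior vertex *)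

(* Coordinates (p, y) of a real vertex, and (p, y, s) of the vertex o_s of the
   precell whose initial vertex has coordinates (p, y); [qedge] is the shadow of
   [pair_edge] on these coordinates. *)
Inductive qvertex := QR of int & int | QI of int & int & int.

Inductive qedge (m : int) : qvertex -> qvertex -> Prop :=
| q_cayley e p y : qedge m (QR p y) (QR (p + sg e 1) (y + 1))
| q_initial p y : qedge m (QR p y) (QI p y 1)
| q_terminal e p y : qedge m (QI p y (m - 2)) (QR (p + sg e m) (y + m))
| q_spine p y s : 1 <= s <= m - 3 -> qedge m (QI p y s) (QI p y (s + 1))
| q_side e p y s t : t = s \/ t = s + 1 ->
   qedge m (QI p y s) (QR (p + sg e t) (y + t))
| q_rung e p y d s : 1 <= d <= m - 2 -> 1 <= s <= m - d - 1 ->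
   qedge m (QI p y (d - 1 + s)) (QI (p + sg e d) (y + d) s)
| q_zigzag e p y d s : 1 <= d <= m - 2 -> 1 <= s <= m - d - 2 ->
   qedge m (QI (p + sg e d) (y + d) s) (QI p y (d + s)).

(* The fibres of the retraction onto the hexagon around o_s, the initial vertex
   of whose precell is the origin: -2, -1, 0, 1, 2, 3 (mod 6) stand for q_s,
   q_(s+1), o_(s+1), p_(s+1), p_s, o_(s-1). *)
Inductive sector (m s : int) : int -> qvertex -> Prop :=
| s_lower_real e : sector m s (sg e 2) (QR (sg e s) s)
| s_lower_down e d : 1 <= d <= m - 1 - s ->
   sector m s (sg e 2) (QI (sg e (- d)) (- d) (s + d - 1))
| s_lower_level e d : 1 <= d <= s - 1 ->
   sector m s (sg e 2) (QI (sg e d) d (s - d))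
| s_upper_real e : sector m s (sg e 1) (QR (sg e (s + 1)) (s + 1))
| s_upper_up e d : 1 <= d <= s ->
   sector m s (sg e 1) (QI (sg e d) d (s - d + 1))
| s_upper_level e d : 1 <= d <= m - 2 - s ->
   sector m s (sg e 1) (QI (sg e (- d)) (- d) (s + d))
| s_top : s + 1 <= m - 2 -> sector m s 0 (QI 0 0 (s + 1))
| s_top_real e : s = m - 2 -> sector m s 0 (QR (sg e m) m)
| s_bottom : 1 <= s - 1 -> sector m s 3 (QI 0 0 (s - 1))
| s_bottom_real : s = 1 -> sector m s 3 (QR 0 0).

(* A consequence of p = p' modulo 2 m that stays within linear arithmetic. *)
Definition peq (m p p' : int) :=
  p = p' \/ p = p' + 2 * m \/ p = p' - 2 * m \/
  (p - p' <= - (4 * m)) \/ (p - p' >= 4 * m).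

Definition qsame (m : int) (q q' : qvertex) : Prop :=
  match q, q' with
  | QR p y, QR p' y' => y = y' /\ peq m p p'
  | QI p y s, QI p' y' s' => y = y' /\ s = s' /\ peq m p p'
  | _, _ => False
  end.

(* Equal or adjacent on the hexagon. *)
Definition near (c c' : int) : bool := c - c' \in [:: 0; 1; -1; 5; -5].

(** Once the directions are fixed, each pair of sectors either has near labels or has coordinates
    that contradict each other in linear arithmetic. *)
Lemma sector_same (m s c c' : int) q q' :
  3 <= m -> 1 <= s <= m - 2 -> sector m s c q -> sector m s c' q' ->
  qsame m q q' -> near c c'.
Proof.
move=> m3 sm h h' hs; rewrite /near.
case: h hs => [e|e d hd|e d hd|e|e d hd|e d hd|hd|e hd|hd|hd] hs;
  case: h' hs => [f|f d' hd'|f d' hd'|f|f d' hd'|f d' hd'|hd'|f hd'|hd'|hd'] //= hs;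
  repeat match goal with e : bool |- _ => destruct e end;
  rewrite /sg /peq /= in hs *; first [by [] | exfalso; lia].
Qed.

(** With [sector_same], this makes the retraction simplicial; [r] and [q'] may be two lifts of the
    coordinates of one vertex. *)
Lemma sector_edge (m s c c' : int) q q' r :
  3 <= m -> 1 <= s <= m - 2 -> sector m s c q -> sector m s c' q' ->
  qedge m q r -> qsame m r q' -> near c c'.
Proof.
move=> m3 sm h h' hqr hs; rewrite /near.
case: h hqr => [e|e d hd|e d hd|e|e d hd|e d hd|hd|e hd|hd|hd] hqr;
  inversion hqr as [e1 ? ?|? ?|e1 ? ?|? ? ? hd1|e1 ? ? ? ? ht|e1 ? ? ? ? hd1 hs1
    |e1 ? ? ? ? hd1 hs1]; clear hqr; subst r;
  case: h' hs => [f|f d' hd'|f d' hd'|f|f d' hd'|f d' hd'|hd'|f hd'|hd'|hd'] //= hs;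
  repeat match goal with e : bool |- _ => destruct e end;
  rewrite /sg /peq /= in hs *; unfold sg in *; first [by [] | exfalso; lia].
Qed.

Lemma sector_range (m s c : int) q : sector m s c q -> -2 <= c <= 3.
Proof. by case=> [[]|[]|[]|[]|[]|[]| | | |]. Qed.

(** On labels from -2 to 3, a difference of 3 is the diameter of the hexagon, out of reach of two
    steps. *)
Lemma sector_opposite (m s c c' c'' : int) q q' q'' :
  sector m s c q -> sector m s c' q' -> sector m s c'' q'' ->
  `|c - c'| = 3 -> near c c'' -> near c'' c' -> False.
Proof.
by move=> /sector_range ? /sector_range ? /sector_range ?; rewrite /near !inE; lia.
Qed.

Lemma link_sector (m s : int) q : 3 <= m -> 1 <= s <= m - 2 ->
  qedge m (QI 0 0 s) q \/ qedge m q (QI 0 0 s) -> exists c, sector m s c q.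
Proof.
move=> m3 sm; case=> hq; inversion hq as [e1 ? ?|? ?|e1 p y|p y s0 hd1|e1 p y s0 t ht
  |e1 p y d s0 hd1 hs1|e1 p y d s0 hd1 hs1]; clear hq; subst q.
- by exists 0; rewrite !add0r; apply: s_top_real.
- by exists 0; apply: s_top; lia.
- rewrite !add0r; case: ht => ->.
    by exists (sg e1 2); apply: s_lower_real.
  by exists (sg e1 1); apply: s_upper_real.
- exists (sg e1 1); rewrite !add0r.
  have {2}-> : s0 = d - 1 + s0 - d + 1 by lia.
  by apply: s_upper_up; lia.
(* Here the centre lies in the later precell, so the initial vertex of the earlier one has negative
   coordinates. *)
- exists (sg e1 1); have -> : p = sg e1 (- d) by case: (e1) H => /=; lia.
  have -> : y = - d by lia.
  by rewrite [d + s]addrC; apply: s_upper_level; lia.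
- by exists 3; apply: s_bottom_real.
- exists 3; have {2}-> : s0 = s0 + 1 - 1 by lia.
  by apply: s_bottom; lia.
- exists (sg e1 2); have -> : p = sg e1 (- d) by case: (e1) H0 => /=; lia.
  have -> : y = - d by lia.
  have -> : d - 1 + s = s + d - 1 by lia.
  by apply: s_lower_down; lia.
- exists (sg e1 2); rewrite !add0r.
  have {2}-> : s0 = d + s0 - d by lia.
  by apply: s_lower_level; lia.
Qed.

(** * Coordinates of the vertices of the complex *)

Section Link.
Variables (n : nat) (M : 'M[option nat]_n) (G : groupType) (a : 'I_n -> G).
Hypotheses (hM : coxeter_matrix M) (hG : artin_group M a).
Variable z : 'I_n -> 'I_n -> algC.
Hypothesis hz : braid_roots M z.
Variables (i j : 'I_n) (m : nat).
Hypotheses (ij : (i < j)%N) (Mij : M i j = Some m) (m3 : (3 <= m)%N).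
Variable g : G.
Local Notation V := (vertex n G).
Local Notation located := (located a z i j g).

(** A relation and not a function, since a position is only determined modulo 2 m. *)
Definition vcoord (v : V) (q : qvertex) : Prop :=
  match v, q with
  | Real h, QR p y => exists b, located h p b y
  | Interior _ _ h s, QI p y s' => s%:Z = s' /\ exists b, located h p b y
  | _, _ => False
  end.

(* Edges of the translates of X_ij. *)
Definition tedge (u v : V) : Prop := exists h u0 v0,
  [/\ pair_edge a i j m u0 v0, u = act_vertex h u0 & v = act_vertex h v0].

Lemma half_mul h c x k :
  (h * Defs.half a i j c x k)%g = Defs.half a i j c (h * x)%g k.
Proof. by rewrite /Defs.half mulgA. Qed.

(** The common path starts at the initial vertex of the second precell. The distance m - l is the
    offset d in the rungs and zigzags of [qedge]. *)
Lemma meet_in_path_initial x y l : meet_in_path a i j m x y l ->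
  exists c, y = Defs.half a i j c x (m - l).
Proof.
move=> [_ _ _ [c [c' [/(_ 0 isT) + _ _]]]]; rewrite addn0 => E.
by exists c; rewrite E half0.
Qed.

Lemma vcoord_same v q q' : vcoord v q -> vcoord v q' -> qsame m q q'.
Proof.
have peq_of p b y p' b' y' h : located h p b y -> located h p' b' y' ->
    y = y' /\ peq m p p'.
  move=> h1 h2; have [-> [r hr]] := located_uniq hM hG hz ij Mij h1 h2.
  split=> //; rewrite /peq.
  have [r2|[r2|[r2|[r2|r2]]]] : r = 0 \/ r = 1 \/ r = -1 \/ r <= -2 \/ 2 <= r by lia.
  - by left; move: hr; rewrite r2; lia.
  - by right; left; move: hr; rewrite r2; lia.
  - by right; right; left; move: hr; rewrite r2; lia.
  - by right; right; right; left; nia.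
  - by right; right; right; right; nia.
by case: v q q' => [h|i' j' h s] [p y|p y s1] [p' y'|p' y' s2] //=;
  [move=> [b h1] [b' h2] | move=> [<- [b h1]] [<- [b' h2]]];
  have [? ?] := peq_of _ _ _ _ _ _ _ h1 h2.
Qed.

Lemma located_half_sg h p b y c t : located h p b y ->
  exists e b', located (Defs.half a i j c h t) (p + sg e t%:Z) b' (y + t%:Z).
Proof. by move=> /(located_half hM hz ij Mij c t) ?; do 2 eexists; eauto. Qed.

Lemma located_half_back_sg h p b y c t : located (Defs.half a i j c h t) p b y ->
  exists p' y' e b', [/\ located h p' b' y', p = p' + sg e t%:Z & y = y' + t%:Z].
Proof.
move=> /(located_half_back hM hz ij Mij)[b' [_ hc]].
by exists (p - sg (c (+) b') t%:Z), (y - t%:Z), (c (+) b'), b'; rewrite !subrK.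
Qed.

Lemma tedge_coord u v q : tedge u v -> vcoord u q ->
  exists2 q', qedge m q q' & vcoord v q'.
Proof.
move=> [h [u0 [v0 [E -> ->]]]]; case: E => /=.
- move=> x k _ hk.
  have [c ->] : exists c, k = letter i j c.
    by move: hk; rewrite !inE => /orP[]/eqP->; [exists true|exists false].
  case: q => // p y [b hb].
  have := located_letter hM hz ij Mij c true hb; rewrite mulgA => hc.
  by exists (QR (p + sg (c (+) b) 1) (y + 1)); [constructor | exists (~~ b)].
- by move=> x _ m2; move: m3; rewrite m2.
- move=> x _ _; case: q => // p y hb.
  by exists (QI p y 1); [constructor|].
- move=> x _ _; case: q => // p y s [hs [b /(located_half_sg true m)[e [b' hb]]]].
  exists (QR (p + sg e m%:Z) (y + m%:Z)); last by exists b'; rewrite half_mul.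
  have <- : m%:Z - 2 = s by lia.
  by constructor.
- move=> x s _ _ hs; case: q => // p y s' [hs' hb].
  exists (QI p y (s' + 1)); last by split=> //; lia.
  by constructor; lia.
- move=> x s c t _ _ hs ht; case: q => // p y s' [hs' [b /(located_half_sg c t)[e [b' hb]]]].
  exists (QR (p + sg e t%:Z) (y + t%:Z)); last by exists b'; rewrite half_mul.
  by constructor; move: ht; rewrite !inE => /orP[]/eqP->; [left|right]; lia.
- move=> x x' l s _ _ hl hs; have [c ->] := meet_in_path_initial hl.
  have [_ l2 lm _] := hl.
  case: q => // p y s' [hs' [b /(located_half_sg c (m - l))[e [b' hb]]]].
  exists (QI (p + sg e (m - l)%N%:Z) (y + (m - l)%N%:Z) s%:Z); last first.
    by split=> //; exists b'; rewrite half_mul.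
  have <- : (m - l)%N%:Z - 1 + s%:Z = s' by lia.
  by constructor; lia.
- move=> x x' l s _ _ hl hs; have [c ->] := meet_in_path_initial hl.
  have [_ l2 lm _] := hl.
  case: q => // p y s' [hs' [b]]; rewrite half_mul.
  move=> /located_half_back_sg[p' [y' [e [b' [hb -> ->]]]]].
  exists (QI p' y' ((m - l)%N%:Z + s')); last by split; [lia | exists b'].
  by constructor; lia.
Qed.

Lemma tedge_coord_back u v q : tedge v u -> vcoord u q ->
  exists2 q', qedge m q' q & vcoord v q'.
Proof.
move=> [h [v0 [u0 [E -> ->]]]]; case: E => /=.
- move=> x k _ hk.
  have [c ->] : exists c, k = letter i j c.
    by move: hk; rewrite !inE => /orP[]/eqP->; [exists true|exists false].
  case: q => // p y [b hb].
  have := located_letter hM hz ij Mij c false hb.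
  rewrite /= -!mulgA mulgV mulg1 => hc.
  exists (QR (p + sg (c (+) b) 1) (y - 1)); last by exists (~~ b).
  have {2}-> : y = y - 1 + 1 by lia.
  have {2}-> : p = p + sg (c (+) b) 1 + sg (~~ (c (+) b)) 1.
    by case: (c (+) b) => /=; lia.
  by constructor.
- by move=> x _ m2; move: m3; rewrite m2.
- move=> x _ _; case: q => // p y s [<- hb].
  by exists (QR p y); [constructor|].
- move=> x _ _; case: q => // p y [b]; rewrite half_mul.
  move=> /located_half_back_sg[p' [y' [e [b' [hb -> ->]]]]].
  exists (QI p' y' (m%:Z - 2)); first by constructor.
  by split; [lia | exists b'].
- move=> x s _ _ hs; case: q => // p y s' [<- hb].
  exists (QI p y s%:Z) => //.
  have -> : s.+1%:Z = s%:Z + 1 by lia.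
  by constructor; lia.
- move=> x s c t _ _ hs ht; case: q => // p y [b]; rewrite half_mul.
  move=> /located_half_back_sg[p' [y' [e [b' [hb -> ->]]]]].
  exists (QI p' y' s%:Z); last by split => //; exists b'.
  by constructor; move: ht; rewrite !inE => /orP[]/eqP->; [left|right]; lia.
- move=> x x' l s _ _ hl hs; have [c ->] := meet_in_path_initial hl.
  have [_ l2 lm _] := hl.
  case: q => // p y s' [<- [b]]; rewrite half_mul.
  move=> /located_half_back_sg[p' [y' [e [b' [hb -> ->]]]]].
  exists (QI p' y' ((m - l)%N%:Z - 1 + s%:Z)); last by split; [lia | exists b'].
  by constructor; lia.
- move=> x x' l s _ _ hl hs; have [c ->] := meet_in_path_initial hl.
  have [_ l2 lm _] := hl.
  case: q => // p y s' [<- [b /(located_half_sg c (m - l))[e [b' hb]]]].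
  exists (QI (p + sg e (m - l)%N%:Z) (y + (m - l)%N%:Z) s%:Z); last first.
    by split=> //; exists b'; rewrite half_mul.
  have -> : (m - 1 - l + s.+1)%N%:Z = (m - l)%N%:Z + s%:Z by lia.
  by constructor; lia.
Qed.

Variable s : nat.
Hypothesis sm : (1 <= s <= m - 2)%N.

Definition adjacent (u v : V) : Prop := tedge u v \/ tedge v u.

Definition in_sector (c : int) (v : V) : Prop :=
  exists2 q, sector m s c q & vcoord v q.

Lemma vcoord_center : vcoord (Interior i j g s) (QI 0 0 s).
Proof. by split=> //; exists false; exact: located0. Qed.

Lemma adjacent_sector v : adjacent (Interior i j g s) v ->
  exists c, in_sector c v.
Proof.
have m3' : 3 <= m%:Z by lia.
have sm' : 1 <= s%:Z <= m%:Z - 2 by lia.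
case=> [/tedge_coord/(_ vcoord_center)[q hq hv]
      | /tedge_coord_back/(_ vcoord_center)[q hq hv]].
  by have [c] := link_sector m3' sm' (or_introl hq); exists c, q.
by have [c] := link_sector m3' sm' (or_intror hq); exists c, q.
Qed.

Lemma near_sym c c' : near c c' -> near c' c.
Proof. by rewrite /near !inE; lia. Qed.

Lemma in_sector_near c c' u v : in_sector c u -> in_sector c' v ->
  u = v \/ adjacent u v -> near c c'.
Proof.
have m3' : 3 <= m%:Z by lia.
have sm' : 1 <= s%:Z <= m%:Z - 2 by lia.
have edge c1 c2 x y : in_sector c1 x -> in_sector c2 y -> tedge x y -> near c1 c2.
  move=> [q hq xq] [q' hq' yq'] /tedge_coord/(_ xq)[r qr yr].
  exact: sector_edge hq hq' qr (vcoord_same yr yq').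
move=> hu hv [uv|[uv|vu]].
- move: hu hv => [q hq uq] [q' hq' vq']; rewrite -uv in vq'.
  exact: sector_same hq hq' (vcoord_same uq vq').
- exact: edge uv.
- by apply: near_sym; exact: edge vu.
Qed.

(** As [v] is in the link it has a sector, so u, v, t would map to a path of length at most 2
    between opposite vertices of the hexagon. *)
Lemma opposite_sectors_far c c' u t v : `|c - c'| = 3 ->
  in_sector c u -> in_sector c' t -> adjacent (Interior i j g s) v ->
  u = v \/ adjacent u v -> v = t \/ adjacent v t -> False.
Proof.
move=> cc hu ht /adjacent_sector[c2 hv] uv vt.
have n1 := in_sector_near hu hv uv; have n2 := in_sector_near hv ht vt.
move: hu ht hv => [q hq _] [q' hq' _] [q'' hq'' _].
exact: sector_opposite hq hq' hq'' cc n1 n2.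
Qed.

Definition spine_neighbour (up : bool) : V :=
  if up then if s == (m - 2)%N then Real (Defs.half a i j true g m)
             else Interior i j g s.+1
  else if s == 1%N then Real g else Interior i j g s.-1.

Lemma spine_sector up : in_sector (if up then 0 else 3) (spine_neighbour up).
Proof.
rewrite /spine_neighbour; case: up; case: eqP => sE.
- have := located_half hM hz ij Mij true m (located0 a z i j g).
  rewrite !add0r => hl.
  exists (QR (sg true m) m); first by apply: s_top_real; lia.
  by eexists; exact: hl.
- exists (QI 0 0 (s%:Z + 1)); first by apply: s_top; lia.
  by split; [lia | exists false; exact: located0].
- exists (QR 0 0); first by apply: s_bottom_real; lia.
  by exists false; exact: located0.
- exists (QI 0 0 (s%:Z - 1)); first by apply: s_bottom; lia.
  by split; [lia | exists false; exact: located0].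
Qed.

Lemma half_sector (e : bool) :
  in_sector (sg e 2) (Real (Defs.half a i j e g s)) /\
  in_sector (sg e 1) (Real (Defs.half a i j e g s.+1)).
Proof.
split.
  have := located_half hM hz ij Mij e s (located0 a z i j g).
  rewrite addbF !add0r => hl.
  exists (QR (sg e s) s); first exact: s_lower_real.
  by eexists; exact: hl.
have := located_half hM hz ij Mij e s.+1 (located0 a z i j g).
rewrite addbF !add0r => hl.
have E : s.+1%:Z = s%:Z + 1 by lia.
exists (QR (sg e s.+1) s.+1); first by rewrite E; exact: s_upper_real.
by eexists; exact: hl.
Qed.

(** Opposite to p_s and p_(s+1) are the real vertices q_(s+1) and q_s, and conversely; the two spine
    neighbours are opposite to each other. *)
Lemma opposite_exists u : adjacent (Interior i j g s) u ->
  exists c, in_sector c u /\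
  ((exists e t, (t \in [:: s; s.+1]) /\
     exists c', `|c - c'| = 3 /\ in_sector c' (Real (Defs.half a i j e g t))) \/
   (exists up, `|c - (if up then 0 else 3)| = 3)).
Proof.
move=> /adjacent_sector[c hu]; exists c; split=> //.
have [q hq _] := hu; have := sector_range hq => cr.
have : c = 0 \/ c = 3 \/ (exists e, c = sg e 2 \/ c = sg e 1).
  have : c = -2 \/ c = -1 \/ c = 0 \/ c = 1 \/ c = 2 \/ c = 3 by lia.
  case=> [|[|[|[|[]]]]] ->; first [by left | by right; left | right; right].
  - by exists false; left.
  - by exists false; right.
  - by exists true; right.
  - by exists true; left.
case=> [->|[->|[e ce]]]; [by right; exists false | by right; exists true | left].
have [h2 h1] := half_sector (~~ e); exists (~~ e).
case: ce => ->.
- exists s.+1; split; first by rewrite !inE eqxx orbT.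
  by exists (sg (~~ e) 1); split=> //; case: (e).
- exists s; split; first by rewrite !inE eqxx.
  by exists (sg (~~ e) 2); split=> //; case: (e).
Qed.

End Link.

Local Close Scope ring_scope.
Local Open Scope classical_set_scope.

(** * Simplices and directed geodesics *)

Section DirectedGeodesics.
Variables (n : nat) (G : groupType).
Local Notation V := (vertex n G).
Variable X : set (set V).

(** Only the last pair and the last triple are new, and there is a new triple only if [s] is
    non-empty. *)
Lemma directed_geodesic_rcons (s : seq (set V)) sigma tau :
  directed_geodesic X (rcons s sigma) -> X tau -> sigma `&` tau = set0 ->
  X (sigma `|` tau) ->
  (forall s' rho, s = rcons s' rho ->
     Res rho (link X sigma) `&` B1 tau (link X sigma) = set0) ->
  directed_geodesic X (rcons (rcons s sigma) tau).
Proof.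
move=> [h1 h2 h3] Xt dis Xst hres.
have E k : k < size (rcons s sigma) ->
    nth set0 (rcons (rcons s sigma) tau) k = nth set0 (rcons s sigma) k.
  by move=> hk; rewrite nth_rcons hk.
have Et : nth set0 (rcons (rcons s sigma) tau) (size s).+1 = tau.
  by rewrite nth_rcons size_rcons ltnn eqxx.
have Es : nth set0 (rcons s sigma) (size s) = sigma by rewrite nth_rcons ltnn eqxx.
split=> k; rewrite size_rcons ltnS leq_eqVlt => /predU1P[kE|hk].
- have -> : k = (size s).+1 by move: kE; rewrite size_rcons.
  by rewrite Et.
- by rewrite E //; exact: h1.
- have -> : k = size s by move: kE; rewrite size_rcons => -[].
  by rewrite Et E ?size_rcons // Es.
- by have hk' := ltnW hk; rewrite !E //; exact: h2.
- have ks : size s = k.+1 by move: kE; rewrite size_rcons => -[].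
  have -> : k.+2 = (size s).+1 by rewrite ks.
  rewrite Et !E ?size_rcons ?ks // -ks Es.
  case/lastP: s ks {h1 h2 h3 E Et kE} Es hres => // s' rho.
  rewrite size_rcons => -[ks] Es /(_ s' rho erefl) <-.
  by rewrite -ks nth_rcons size_rcons ltnS leqnn nth_rcons ltnn eqxx.
- by have hk' := ltnW hk; have hk2 := ltnW hk'; rewrite !E //; exact: h3.
Qed.

Lemma directed_geodesic_take k (s : seq (set V)) :
  directed_geodesic X s -> directed_geodesic X (take k s).
Proof.
move=> [h1 h2 h3].
have lt_take r : r < size (take k s) -> r < size s /\ nth set0 (take k s) r = nth set0 s r.
  by move=> hr; have := hr; rewrite size_take_min leq_min => /andP[rk rs];
     rewrite nth_take.
split=> r hr.
- by have [? ->] := lt_take _ hr; exact: h1.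
- have [? ->] := lt_take _ hr; have [? ->] := lt_take _ (ltnW hr); exact: h2.
- have [? ->] := lt_take _ hr; have [? ->] := lt_take _ (ltnW hr).
  have [? ->] := lt_take _ (ltnW (ltnW hr)); exact: h3.
Qed.

(** Members of [Res] are non-empty, so a common simplex has a vertex [v], and it suffices to exclude
    vertices. *)
Lemma Res_B1_disjoint (rho sigma tau : set V) :
  (forall rho1 rho2 v, rho `<=` rho1 -> rho1 v -> rho2 v -> rho2 `&` tau !=set0 ->
     link X sigma rho1 -> link X sigma rho2 -> False) ->
  Res rho (link X sigma) `&` B1 tau (link X sigma) = set0.
Proof.
move=> h; rewrite -subset0 => T [[[v Tv] [rho1 [l1 s1 T1]]] [_ [rho2 [l2 m2 T2]]]].
exact: (h rho1 rho2 v s1 (T1 _ Tv) (T2 _ Tv) m2 l1 l2).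
Qed.

End DirectedGeodesics.

(** * Faces and edges of the complex *)

Section Simplices.
Variables (n : nat) (M : 'M[option nat]_n) (G : groupType) (a : 'I_n -> G).
Local Notation V := (vertex n G).
Local Notation X := (complexX M a).

Lemma complexX_nonempty S : X S -> S !=set0.
Proof.
case=> [[h ->]|[h [k ->]]|[i [j [m [h [tau [_ _ [_ [v tv] _ _] ->]]]]]]].
- by exists (Real h).
- by exists (Real h); left.
- by exists (act_vertex h v), v.
Qed.

Lemma complexX_sub S T : X S -> T `<=` S -> T !=set0 -> X T.
Proof.
move=> XS TS [t Tt].
have one x : T `<=` [set x] -> T = [set x].
  move=> Tx; rewrite eqEsubset; split=> // y ->.
  by rewrite -(Tx t Tt).
case: XS => [[h SE]|[h [k SE]]|[i [j [m [h [tau [ij Mij [fin _ pv adj] SE]]]]]]].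
- by constructor 1; exists h; apply: one; rewrite -SE.
- have [Th|nTh] := pselect (T (Real h)); have [Tk|nTk] := pselect (T (Real (h * a k)%g)).
  + constructor 2; exists h, k; rewrite eqEsubset; split; first by rewrite -SE.
    by move=> y [->|->].
  + constructor 1; exists h; apply: one => y Ty.
    by have := TS y Ty; rewrite SE => -[//|yk]; rewrite yk in Ty.
  + constructor 1; exists (h * a k)%g; apply: one => y Ty.
    by have := TS y Ty; rewrite SE => -[yk|//]; rewrite yk in Ty.
  + by have := TS t Tt; rewrite SE => -[tk|tk]; rewrite tk in Tt.
- constructor 3; exists i, j, m, h, (tau `&` [set v | T (act_vertex h v)]); split=> //.
    split.
    + exact: finite_setIl.
    + by have := TS t Tt; rewrite SE => -[v tv vt]; exists v; split=> //=; rewrite vt.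
    + by move=> v [/pv].
    + by move=> u v [tu _] [tv _]; exact: adj.
  rewrite eqEsubset; split=> [y Ty|y [v [_ /=Tv] <-//]].
  by have := TS y Ty; rewrite SE => -[v tv vy]; exists v => //; split=> //=; rewrite vy.
Qed.

(** An interior vertex carries its pair {i, j}, so a simplex containing it comes from a translate of
    that X_ij. *)
Lemma complexX_interior S i j g s : X S -> S (Interior i j g s) ->
  exists m, [/\ i < j, M i j = Some m, 1 <= s <= m - 2 &
    forall u v, S u -> S v -> u <> v -> adjacent a i j m u v].
Proof.
case=> [[h ->]//|[h [k ->]] [//|//]|].
move=> [i' [j' [m [h [tau [ij Mij [_ _ pv adj] ->]]]]]] [w tw wE].
have [[x [_ wx]]|[x [s' [_ hs wx]]]] := pv w tw; first by rewrite wx in wE.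
move: wE; rewrite wx => -[<- <- _ <-]; exists m; split=> // _ _ [u tu <-] [v tv <-] uv.
have [uv'|vu'] : pair_edge a i' j' m u v \/ pair_edge a i' j' m v u.
    by apply: adj => // E; rewrite E in uv.
  by left; exists h, u, v.
by right; exists h, v, u.
Qed.

Section Pair.
Variables (i j : 'I_n) (m : nat).
Hypotheses (ij : i < j) (Mij : M i j = Some m).

Lemma complexX_edge h u v : pair_vertex a i j m u -> pair_vertex a i j m v ->
  pair_edge a i j m u v \/ pair_edge a i j m v u ->
  X [set act_vertex h u; act_vertex h v].
Proof.
move=> pu pv uv; constructor 3; exists i, j, m, h, [set u; v]; split=> //.
  split; [exact: finite_set2 | by exists u; left | by move=> x [->|->] |].
  by move=> x y [->|->] [->|->] nxy; [case: nxy | | apply/or_comm | case: nxy].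
rewrite /act image_setU !image_set1 //.
Qed.

Lemma Gpair_half c x t : Gpair a i j x -> Gpair a i j (Defs.half a i j c x t).
Proof.
move=> hx; elim: t c x hx => [|t IH] c x hx.
  by rewrite half0.
rewrite half_step; apply: IH => H [[H1 HM] Hs].
(* [generated] closes under x y^-1, so a generator is multiplied in as the inverse of its
   inverse. *)
rewrite -[a _]invgK; apply: (HM); first exact: (hx H (conj (conj H1 HM) Hs)).
rewrite -[(a _)^-1%g]mul1g; apply: HM => //; apply: Hs; rewrite /letter.
by case: (c); [left | right].
Qed.

Lemma Gpair1 : Gpair a i j 1%g.
Proof. by move=> H [[]]. Qed.

Variables (g : G) (s : nat).
Hypotheses (m3 : 3 <= m) (sm : 1 <= s <= m - 2).

Lemma complexX_half c t : t \in [:: s; s.+1] ->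
  X [set Interior i j g s; Real (Defs.half a i j c g t)].
Proof.
move=> ht.
(* [g] need not lie in G_ij, so the edge is taken in the precell at 1 and translated. *)
have := @complexX_edge g (Interior i j 1%g s) (Real (Defs.half a i j c 1%g t)).
rewrite /= half_mul mulg1; apply.
- by right; exists 1%g, s; split => //; exact: Gpair1.
- by left; eexists; split=> //; apply: Gpair_half; exact: Gpair1.
- by left; constructor => //; exact: Gpair1.
Qed.

Lemma complexX_spine up :
  X [set Interior i j g s; spine_neighbour a i j m g s up].
Proof.
rewrite /spine_neighbour; case: up; case: eqP => sE.
- have := @complexX_edge g (Interior i j 1%g s) (Real (Defs.half a i j true 1%g m)).
  rewrite /= half_mul mulg1; apply.
  + by right; exists 1%g, s; split => //; exact: Gpair1.
  + by left; eexists; split=> //; apply: Gpair_half; exact: Gpair1.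
  + by left; rewrite sE; constructor => //; exact: Gpair1.
- have := @complexX_edge g (Interior i j 1%g s) (Interior i j 1%g s.+1).
  rewrite /= mulg1; apply.
  + by right; exists 1%g, s; split => //; exact: Gpair1.
  + by right; exists 1%g, s.+1; split => //; [exact: Gpair1 | lia].
  + by left; constructor => //; [exact: Gpair1 | lia].
- have := @complexX_edge g (Interior i j 1%g s) (Real 1%g).
  rewrite /= mulg1; apply.
  + by right; exists 1%g, s; split => //; exact: Gpair1.
  + by left; exists 1%g; split=> //; exact: Gpair1.
  + by right; rewrite sE; constructor => //; exact: Gpair1.
- have := @complexX_edge g (Interior i j 1%g s) (Interior i j 1%g s.-1).
  rewrite /= mulg1; apply.
  + by right; exists 1%g, s; split => //; exact: Gpair1.
  + by right; exists 1%g, s.-1; split => //; [exact: Gpair1 | lia].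
  + right; have {2}-> : s = s.-1.+1 by lia.
    by constructor => //; [exact: Gpair1 | lia].
Qed.

End Pair.
End Simplices.

(** * From an interior vertex to a real one *)

Section Escape.
Variables (n : nat) (M : 'M[option nat]_n) (G : groupType) (a : 'I_n -> G).
Hypotheses (hM : coxeter_matrix M) (hG : artin_group M a).
Variable z : 'I_n -> 'I_n -> algC.
Hypothesis hz : braid_roots M z.
Variables (i j : 'I_n) (m : nat).
Hypotheses (ij : i < j) (Mij : M i j = Some m) (m3 : 3 <= m).
Variable g : G.
Local Notation V := (vertex n G).
Local Notation X := (complexX M a).
Local Notation o s := (Interior i j g s : V).
Local Notation in_sector := (in_sector a z i j m g).
Local Notation spine := (spine_neighbour a i j m g).

(** One vertex [u] of [rho] is enough: simplices in the definition of [Res] contain all of [rho], so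
    a common vertex v would join u to t in the link. *)
Lemma opposite_link_condition s (rho : set V) u t c c' : 1 <= s <= m - 2 ->
  rho u -> in_sector s c u -> in_sector s c' t -> `|c - c'|%R = 3%R ->
  Res rho (link X [set o s]) `&` B1 [set t] (link X [set o s]) = set0.
Proof.
move=> sm hu cu ct cc; apply: Res_B1_disjoint.
have adj r x y : link X [set o s] r -> r x -> r y ->
    adjacent a i j m (o s) x /\ (x = y \/ adjacent a i j m x y).
  move=> [_ dis Xr] rx ry.
  have [|m' [_ Mij' _ adj]] := complexX_interior Xr (i := i) (j := j) (g := g) (s := s).
    by right.
  have mm : m' = m by move: Mij'; rewrite Mij => -[].
  rewrite mm in adj; split; last first.
    have [->|xy] := EM (x = y); [by left | right].
    by apply: adj => //; left.
  apply: adj; [by right | by left | move=> E].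
  by have : (r `&` [set o s]) x; [split | rewrite dis].
move=> r1 r2 v rr1 r1v r2v [t' [r2t tt]] l1 l2; rewrite tt in r2t.
have [_ uv] := adj _ _ _ l1 (rr1 _ hu) r1v; have [av vt] := adj _ _ _ l2 r2v r2t.
exact: (opposite_sectors_far hM hG hz ij Mij m3 sm cc cu ct av uv vt).
Qed.

Lemma directed_geodesic_opposite s pre (rho : set V) u t c c' : 1 <= s <= m - 2 ->
  directed_geodesic X (rcons (rcons pre rho) [set o s]) ->
  rho u -> in_sector s c u -> in_sector s c' t -> `|c - c'|%R = 3%R ->
  t <> o s -> X [set o s; t] ->
  directed_geodesic X (rcons (rcons (rcons pre rho) [set o s]) [set t]).
Proof.
move=> sm dg hu cu ct cc nt Xt; apply: directed_geodesic_rcons => //.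
- by apply: (complexX_sub Xt); [move=> ? ->; right | exists t].
- by rewrite -subset0 => ? [-> E]; case: nt.
- move=> s' r /rcons_inj[_ <-].
  exact: opposite_link_condition hu cu ct cc.
Qed.

(** Induction on the distance left to the end of the spine. After a step, the old centre is the
    backward spine neighbour of the new one, so the next spine vertex is again opposite to the
    predecessor. *)
Lemma spine_escape up N s pre (rho : set V) u c : 1 <= s <= m - 2 ->
  (if up then m - 1 - s else s) <= N ->
  directed_geodesic X (rcons (rcons pre rho) [set o s]) ->
  rho u -> in_sector s c u -> `|c - (if up then 0 else 3)|%R = 3%R ->
  exists ext h, [/\ directed_geodesic X (rcons (rcons pre rho) [set o s] ++ ext),
    last [set o s] ext = [set Real h] & size ext <= N].
Proof.
elim: N s pre rho u c => [|N IH] s pre rho u c sm sN dg hu cu cc.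
  by exfalso; case: (up) sN; lia.
have ct := spine_sector a hM hz ij Mij m3 g sm up.
have Xt := complexX_spine a ij Mij g m3 sm up.
have nt : spine s up <> o s.
  rewrite /spine_neighbour; case: (up); case: eqP => // _ [E]; move: sm; lia.
have dg' := directed_geodesic_opposite sm dg hu cu ct cc nt Xt.
have real_case h : spine s up = Real h -> exists ext h, [/\
    directed_geodesic X (rcons (rcons pre rho) [set o s] ++ ext),
    last [set o s] ext = [set Real h] & size ext <= N.+1].
  move=> E; exists [:: [set Real h]], h; split=> //.
  by rewrite cats1 -E.
have interior_case s' : spine s up = o s' -> 1 <= s' <= m - 2 ->
    (if up then m - 1 - s' else s') <= N -> spine s' (~~ up) = o s ->
    exists ext h, [/\
    directed_geodesic X (rcons (rcons pre rho) [set o s] ++ ext),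
    last [set o s] ext = [set Real h] & size ext <= N.+1].
  move=> E sm' sN' E'; rewrite E in dg'.
  have cu' := spine_sector a hM hz ij Mij m3 g sm' (~~ up); rewrite E' in cu'.
  have [|ext [h [d l e]]] := IH s' _ _ (o s) _ sm' sN' dg' erefl cu'.
    by case: (up).
  exists ([set o s'] :: ext), h; split=> //.
  by rewrite -cat_rcons.
rewrite /spine_neighbour in real_case interior_case.
case: up {IH} sN cc ct Xt nt dg' real_case interior_case => sN cc ct Xt nt dg'.
  case: eqP => [sE + _|sE _]; first by apply; reflexivity.
  move/(_ s.+1 erefl); apply; [lia|lia|].
  by case: eqP => // /eqP; rewrite eqSS; move: sm; case: (s).
case: eqP => [sE + _|sE _]; first by apply; reflexivity.
move/(_ s.-1 erefl); apply; [lia|lia|].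
by case: eqP => [|_]; [lia | congr Interior; lia].
Qed.

(** The bound comes from the spine: s steps lead down and m - 1 - s lead up, where 1 <= s <= m -
    2. *)
Lemma interior_escape s pre (rho : set V) : 1 <= s <= m - 2 ->
  directed_geodesic X (rcons (rcons pre rho) [set o s]) ->
  exists ext h, [/\ directed_geodesic X (rcons (rcons pre rho) [set o s] ++ ext),
    last [set o s] ext = [set Real h] & size ext <= m - 2].
Proof.
move=> sm dg; have [h1 h2 _] := dg.
have szE : size (rcons (rcons pre rho) [set o s]) = (size pre).+2 by rewrite !size_rcons.
have Er : nth set0 (rcons (rcons pre rho) [set o s]) (size pre) = rho.
  by rewrite !nth_rcons size_rcons ltnS leqnn ltnn eqxx.
have Eo : nth set0 (rcons (rcons pre rho) [set o s]) (size pre).+1 = [set o s].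
  by rewrite nth_rcons size_rcons ltnn eqxx.
have [u hu] : rho !=set0.
  by have := h1 (size pre); rewrite szE Er => /(_ (leqW (leqnn _)))/complexX_nonempty.
have := h2 (size pre); rewrite szE Er Eo => /(_ (leqnn _))[dis Xu].
have au : adjacent a i j m (o s) u.
  have [|m' [_ Mij' _ adj]] := complexX_interior Xu (i := i) (j := j) (g := g) (s := s).
    by right.
  have mm : m' = m by move: Mij'; rewrite Mij => -[].
  rewrite mm in adj; apply: adj; [by right | by left | move=> E].
  by have : (rho `&` [set o s]) u; [split | rewrite dis].
have [c [cu]] := opposite_exists hM hz ij Mij m3 sm au.
case=> [[e [t [ht [c' [cc ct]]]]]|[up cc]]; last first.
  by apply: (spine_escape sm _ dg hu cu cc); case: (up); lia.
exists [:: [set Real (Defs.half a i j e g t)]], (Defs.half a i j e g t).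
split=> //; last by move: m3 => /=; lia.
rewrite cats1.
have Xt := complexX_half a ij Mij g m3 sm e ht.
by apply: (directed_geodesic_opposite sm dg hu cu ct cc _ Xt).
Qed.

End Escape.

(** * Completing a prefix to a word of the language *)

Lemma directed_geodesic_shrink n (G : groupType) (X : set (set (vertex n G)))
    (pre : seq (set (vertex n G))) (sigma tau : set (vertex n G)) u :
  (forall S T, X S -> T `<=` S -> T !=set0 -> X T) ->
  directed_geodesic X (rcons (rcons pre sigma) tau) -> tau u ->
  directed_geodesic X (rcons (rcons pre sigma) [set u]).
Proof.
move=> Xsub dg tu; have [h1 h2 h3] := dg.
have szE : size (rcons (rcons pre sigma) tau) = (size pre).+2 by rewrite !size_rcons.
have Es : nth set0 (rcons (rcons pre sigma) tau) (size pre) = sigma.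
  by rewrite !nth_rcons size_rcons ltnS leqnn ltnn eqxx.
have Et : nth set0 (rcons (rcons pre sigma) tau) (size pre).+1 = tau.
  by rewrite nth_rcons size_rcons ltnn eqxx.
have Xt : X tau by rewrite -Et; apply: h1; rewrite szE.
have := h2 (size pre); rewrite szE Es Et => /(_ (leqnn _))[dis Xst].
apply: directed_geodesic_rcons.
- have := directed_geodesic_take (size pre).+1 dg.
  by rewrite -cats1 takel_cat ?size_rcons // take_oversize // size_rcons.
- by apply: (Xsub _ _ Xt); [move=> ? -> | exists u].
- rewrite -subset0 => v [sv vu]; rewrite vu in sv.
  by have : (sigma `&` tau) u; [split | rewrite dis].
- apply: (Xsub _ _ Xst); last by exists u; right.
  by move=> v [sv|->]; [left | right].
- move=> s' rho pE.
  have ps : size pre = (size s').+1 by rewrite pE size_rcons.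
  have Er : nth set0 (rcons (rcons pre sigma) tau) (size s') = rho.
    by rewrite pE !nth_rcons !size_rcons !ltnS leqnn leqW // ltnn eqxx.
  have := h3 (size s'); rewrite szE -ps Er Es Et => /(_ (leqnn _)) h.
  rewrite -subset0 -h => T [RT [T0 [r [lr ru Tr]]]]; split=> //; split=> //.
  exists r; split=> //; case: ru => v [rv vu]; rewrite vu in rv.
  by exists u.
Qed.

Lemma label_bound n (M : 'M[option nat]_n) (i j : 'I_n) m :
  i < j -> M i j = Some m ->
  m.-1 <= \max_(i < n) \max_(j < n | (i != j) && (M i j != None))
            (odflt 0 (M i j)).-1.
Proof.
move=> ij Mij.
apply: (bigop.bigmax_sup i) => //; apply: (bigop.bigmax_sup j); last by rewrite Mij.
by rewrite Mij neq_ltn ij.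
Qed.

Lemma take_pairmap (T1 T2 : Type) (f : T1 -> T1 -> T2) x s k :
  take k (pairmap f x s) = pairmap f x (take k s).
Proof. by elim: s x k => [|y s IH] x [|k] //=; rewrite IH. Qed.

Theorem corollary7p6 (n : nat) (M : 'M[option nat]_n) (G : groupType)
    (a : 'I_n -> G) (V0 : set (set (vertex n G)))
    (hM : coxeter_matrix M) (hG : artin_group M a)
    (hnonfree : ~ free_group G) (hlarge : almost_large_type M)
    (hV0 : orbit_representatives M a V0)
    (w w1 w2 : seq G) (x : G)
    (hw : languageL0 M a V0 w) (hw1 : prefix w1 w) (hw2 : w1 = rcons w2 x) :
  exists w' : seq G,
    [/\ languageL0 M a V0 w', prefix w2 w' &
        size w' - size w2 <=
          \max_(i < n) \max_(j < n | (i != j) && (M i j != None))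
            (odflt 0 (M i j)).-1].
Proof.
have [z hz] := braid_roots_exist hM.
case: hw => g0 [s [dg _ wE]].
move: hw1; rewrite hw2 => /prefixP[w3 w3E].
set k := size w2.
have ks : k < size s.
  have := congr1 size w3E; rewrite wE size_pairmap size_cat size_rcons => ->.
  by rewrite addSn ltnS leq_addr.
have w2E : w2 = word_of V0 (@v0 n G) (take k s).
  by rewrite /word_of -take_pairmap -[pairmap _ _ _]wE w3E cat_rcons take_size_cat.
(* [v0] has index 0, so index [size w2] is the end of the path that spells [w2]; the deleted letter
   leads on to [tau]. *)
pose S := @v0 n G :: s; pose sigma := nth set0 S k; pose tau := nth set0 S k.+1.
have tkE : take k.+1 S = rcons (take k S) sigma by apply: take_nth; rewrite /= ltnW.
have lastE : last (@v0 n G) (take k s) = sigma.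
  have := congr1 (last set0) tkE; rewrite last_rcons /= => ->//.
set B := \max_(i < n) _.
(* It suffices to extend the truncated geodesic to a real vertex, as its word then starts with
   [w2]. *)
have finish (ext : seq (set (vertex n G))) h :
    directed_geodesic (complexX M a) (take k.+1 S ++ ext) ->
    last sigma ext = [set Real h] -> size ext <= B ->
    exists w' : seq G, [/\ languageL0 M a V0 w', prefix w2 w' & size w' - size w2 <= B].
  move=> dg' le se; exists (word_of V0 (@v0 n G) (take k s ++ ext)); split.
  - exists h, (take k s ++ ext); split=> //.
    by rewrite last_cat lastE le /act image_set1 /= mulg1.
  - by rewrite w2E /word_of pairmap_cat prefix_prefix.
  - by rewrite w2E !size_pairmap size_cat addKn.
have dgS := directed_geodesic_take k.+1 dg.
have [[h sh]|nreal] := pselect (exists h, sigma = [set Real h]).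
  by apply: (finish [::] h); rewrite ?cats0.
have k0 : 0 < k.
  by rewrite lt0n; apply/eqP => kz; apply: nreal; exists 1%g; rewrite /sigma kz.
have := dg; case=> h1 h2 _.
have := h2 k; rewrite /= ltnS => /(_ ks) [dis Xst].
have Xtau : complexX M a tau by apply: h1; rewrite /= ltnS.
have Xsigma : complexX M a sigma by apply: h1; rewrite /= ltnW.
have [u tu] := complexX_nonempty Xtau; have [v sv] := complexX_nonempty Xsigma.
have tk2E : take k.+2 S = rcons (rcons (take k S) sigma) tau.
  by rewrite -tkE; apply: take_nth.
have dgu : directed_geodesic (complexX M a) (rcons (rcons (take k S) sigma) [set u]).
  apply: directed_geodesic_shrink tu; last by rewrite -tk2E; exact: directed_geodesic_take.
  exact: complexX_sub.
(* A step to a real [u] needs a bound of at least 1, hence a finite label. If the simplex spanned by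
   [sigma] and [tau] were in the Cayley graph, [sigma] would be a real vertex. *)
have [i [j [m [ij Mij]]]] : exists (i j : 'I_n) m, i < j /\ M i j = Some m.
  have no_pair p q : sigma `|` tau = [set Real p; Real q] -> False.
    move=> pq; apply: nreal.
    have in_pair t : sigma t \/ tau t -> t = Real p \/ t = Real q.
      by move=> t2; have : (sigma `|` tau) t by []; rewrite pq.
    have neq t : sigma t -> t <> u.
      move=> st tE; have : (sigma `&` tau) u by split; [rewrite -tE | exact: tu].
      by rewrite dis.
    have unique t : sigma t -> t = v.
      move=> st; have := neq _ st; have := neq _ sv.
      case: (in_pair t (or_introl st)) (in_pair v (or_introl sv))
        (in_pair u (or_intror tu)) => [->|->] [->|->] [->|->] //.
    have : exists h, v = Real h.
      by case: (in_pair v (or_introl sv)) => ->; [exists p | exists q].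
    case=> h vh; exists h; rewrite -vh eqEsubset; split=> [t /unique//|t ->//].
  case: Xst => [[h E]|[h [l E]]|[i [j [m [_ [_ [ij Mij _ _]]]]]]].
  - by case: (no_pair h h); rewrite setUid.
  - by case: (no_pair _ _ E).
  - by exists i, j, m.
have m2 : 2 <= m by case: hM => _ _; apply; last exact: Mij; rewrite neq_ltn ij.
have Bm := label_bound ij Mij; rewrite -/B in Bm.
case uE: u => [h|i' j' g s'].
  apply: (finish [:: [set u]] h); [by rewrite tkE cats1 | by rewrite uE | by move=> /=; lia].
have us : (sigma `|` tau) (Interior i' j' g s') by right; rewrite -uE.
have [m' [ij' Mij' sm' _]] := complexX_interior Xst us.
have Bm' := label_bound ij' Mij'; rewrite -/B in Bm'.
have m3 : 3 <= m' by lia.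
rewrite uE in dgu.
have [ext [h [d l e]]] := interior_escape hM hG hz ij' Mij' m3 sm' dgu.
(* One step to [u] and at most m' - 2 after it. *)
apply: (finish ([set u] :: ext) h).
- by rewrite tkE -cat_rcons uE.
- by rewrite /= uE.
- by apply: leq_trans Bm'; move: m3 e => /=; clear; lia.
Qed.
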